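(* Fix $0<\lambda_0<\lambda_S$. Couple the corresponding Poisson knowledge-point sets on $\mathbb{R}$ by writing a process of intensity $\lambda_S$ as the union of a Poisson process of intensity $\lambda_0$ and an independent Poisson process of intensity $\lambda_S-\lambda_0$. Let $\sigma_0^2(x)$ and $\sigma_S^2(x)$ denote the posterior variances of $Y(x)$ under the $\lambda_0$- and $\lambda_S$-knowledge sets respectively. Then for every task $x$, $$\sigma_S^2(x)\le\sigma_0^2(x)\qquad\text{almost surely}.$$
   Context: $Y$ is a driftless Brownian motion in the task coordinate, observed exactly at the knowledge points. Given a knowledge set, for a task $x$ lying between consecutive knowledge points $u<x<v$ of that set, the posterior variance of $Y(x)$ is the Brownian-bridge variance $\frac{(x-u)(v-x)}{v-u}$ (and it is $0$ if $x$ is a knowledge point). *)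

(* Defs.v *)
From HB Require Import structures.
From mathcomp Require Import all_boot all_order all_algebra.
From mathcomp Require Import all_classical all_reals all_analysis.
From mathcomp Require Import measurable_realfun.

Set Implicit Arguments.
Unset Strict Implicit.
Unset Printing Implicit Defensive.

Import Order.TTheory GRing.Theory Num.Theory.
Import numFieldNormedType.Exports.

Local Open Scope classical_set_scope.
Local Open Scope ring_scope.

(* Number of points of the random set K falling in B, possibly +oo. *)
Definition npoints (R : realType) (T : Type) (K : T -> set R) (B : set R)
  (w : T) : \bar R := counting (K w `&` B).

(* Poisson point process on R with constant intensity l, seen as a random set
   of points.  Local finiteness is not imposed for every w: the law of the
   counts forces it almost surely.  [poisson_prob] is used rather than
   [poisson_pmf] because at mean 0 (Lebesgue-null B) the former is the point
   mass at 0 whereas the latter is constantly 1; the second argument of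
   [poisson_prob] is ignored by its definition. *)
Definition poisson_process (R : realType) (d : measure_display)
    (T : measurableType d) (P : probability T R) (l : R) (K : T -> set R)
    : Prop :=
  [/\ forall B : set R, measurable B -> measurable_fun [set: T] (npoints K B),
      forall (B : set R) (k : nat), measurable B ->
        (lebesgue_measure B < +oo)%E ->
        P [set w | npoints K B w = k%:R%:E] =
        poisson_prob (l * fine (lebesgue_measure B)) 0 [set k]
    & forall (n : nat) (B : 'I_n -> set R) (E : 'I_n -> set (\bar R)),
        (forall i, measurable (B i)) -> trivIset [set: 'I_n] B ->
        (forall i, measurable (E i)) ->
        P (\bigcap_i (npoints K (B i) @^-1` E i)) =
        (\prod_(i < n) P (npoints K (B i) @^-1` E i))%E].

(* The sigma-algebra generated by a random set of points. *)
Definition sigma_points (R : realType) (T : Type) (K : T -> set R)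
    : set (set T) :=
  <<s [set A | exists2 B : set R, measurable B &
         preimage_set_system [set: T] (npoints K B) measurable A] >>.

Definition independent_points (R : realType) (d : measure_display)
    (T : measurableType d) (P : probability T R) (K K' : T -> set R) : Prop :=
  forall A A' : set T, sigma_points K A -> sigma_points K' A' ->
    P (A `&` A') = (P A * P A')%E.

(* The pairs (u, v) of consecutive points of K with u < x < v. *)
Definition bracket (R : realType) (K : set R) (x : R) : set (R * R) :=
  [set p | [/\ K p.1, K p.2, p.1 < x < p.2
             & forall z, K z -> ~~ (p.1 < z < p.2)]].

(* Posterior variance of a driftless Brownian motion (of unit variance rate) at
   x, given its exact values at the points of K.  When x is not in K there is at
   most one bracketing pair; if there is none, the formula is evaluated at the
   default pair (x, x), which gives the junk value 0. *)
Definition posterior_variance (R : realType) (K : set R) (x : R) : R :=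
  if x \in K then 0
  else let: (u, v) := xget (x, x) (bracket K x) in
       (x - u) * (v - x) / (v - u).

(* Main.v *)
(* Adding knowledge points can only shrink the interval between the consecutive
   points around x, and the bridge variance is monotone in that interval.  The
   only probabilistic input is that x is almost surely bracketed by points of
   the coarser set: an interval of length n carries a finite nonzero number of
   points except with probability exp (- l n), so almost surely some interval on
   each side of x does, and its point closest to x exists. *)
Require Import Defs.
From mathcomp Require Import all_boot all_order all_algebra.
From mathcomp Require Import all_classical all_reals all_analysis.
From mathcomp Require Import measurable_realfun.
Import Order.TTheory GRing.Theory Num.Theory.
Local Open Scope classical_set_scope.
Local Open Scope ring_scope.

Lemma finite_set_min {d : Order.disp_t} {T : orderType d} (A : set T) :
  finite_set A -> A !=set0 ->
  exists2 m, A m & forall z, A z -> (m <= z)%O.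
Proof.
move=> /finite_seqP[s ->]; case: s => [|a s] [y ys] //.
elim: s a {y ys} => [|b s IHs] a.
  by exists a => [|z] /=; rewrite mem_seq1 // => /eqP->.
have [m ms mmin] := IHs b.
exists (Order.min a m) => [|z] /=.
  by rewrite /Order.min; case: ifP => _; rewrite inE ?eqxx// [m \in _]ms orbT.
rewrite inE => /orP[/eqP->|zs]; first by rewrite ge_min lexx.
by rewrite ge_min (mmin z zs) orbT.
Qed.

Lemma finite_set_max {d : Order.disp_t} {T : orderType d} (A : set T) :
  finite_set A -> A !=set0 ->
  exists2 m, A m & forall z, A z -> (z <= m)%O.
Proof. exact: (@finite_set_min _ T^d). Qed.

(** The bracket consists of the largest point in the left window and the smallest in the right one.
    A point strictly between them would be [x] itself or lie in a window and contradict
    extremality. *)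
Lemma bracket_nonempty (R : realType) (K : set R) (x a b : R) :
  ~ K x ->
  finite_set (K `&` `]a, x[) -> K `&` `]a, x[ !=set0 ->
  finite_set (K `&` `]x, b[) -> K `&` `]x, b[ !=set0 ->
  bracket K x !=set0.
Proof.
move=> Kx finl nel finr ner.
have [u [Ku /=]] := finite_set_max _ finl nel.
rewrite in_itv/= => /andP[au ux] umax.
have [v [Kv /=]] := finite_set_min _ finr ner.
rewrite in_itv/= => /andP[xv vb] vmin.
exists (u, v); split => //=; first by rewrite ux xv.
move=> z Kz; apply/negP => /andP[uz zv].
have [zx|xz|zx] := ltgtP z x; last by rewrite zx in Kz.
- have := umax z; rewrite leNgt uz /= in_itv/= zx (lt_trans au uz).
  by move=> /(_ (conj Kz isT)).
- have := vmin z; rewrite leNgt zv /= in_itv/= xz (lt_trans zv vb).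
  by move=> /(_ (conj Kz isT)).
Qed.

(** With [a = x - u] and [b = v - x] the variance is [a * b / (a + b)], which increases in each of
    [a] and [b]. *)
Lemma bridge_variance_le (R : realFieldType) (u u' x v v' : R) :
  u' <= u -> u < x -> x < v -> v <= v' ->
  (x - u) * (v - x) / (v - u) <= (x - u') * (v' - x) / (v' - u').
Proof.
move=> u'u ux xv vv'.
have uv := lt_trans ux xv.
have u'v' : u' < v' by rewrite (le_lt_trans u'u)// (lt_le_trans uv).
rewrite ler_pdivrMr ?subr_gt0// mulrAC ler_pdivlMr ?subr_gt0//.
set a := x - u; set b := v - x; set a' := x - u'; set b' := v' - x.
have -> : v' - u' = a' + b' by rewrite /a' /b' [RHS]addrC addrA subrK.
have -> : v - u = a + b by rewrite /a /b [RHS]addrC addrA subrK.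
have a0 : 0 <= a by rewrite subr_ge0 ltW.
have b0 : 0 <= b by rewrite subr_ge0 ltW.
have aa' : a <= a' by rewrite lerB.
have bb' : b <= b' by rewrite lerB.
have a'0 := le_trans a0 aa'; have b'0 := le_trans b0 bb'.
clearbody a b a' b'.
(* After cross-multiplication the inequality splits into [a * b * a' <= a' * b' * a], from
   [b <= b'], and [a * b * b' <= a' * b' * b], from [a <= a']. *)
rewrite !mulrDr lerD//.
  by rewrite mulrAC [leRHS]mulrAC (mulrC a' a) ler_wpM2l// mulr_ge0.
by rewrite [leRHS]mulrAC !ler_wpM2r.
Qed.

Lemma posterior_variance_ge0 (R : realType) (K : set R) (x : R) :
  0 <= posterior_variance K x.
Proof.
rewrite /posterior_variance; case: ifP => // _.
case: xgetP => [[u v] _ [_ _ /= /andP[ux xv] _]|_].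
  by rewrite divr_ge0 ?mulr_ge0 ?subr_ge0 ?ltW// (lt_trans ux).
by rewrite subrr mul0r mul0r.
Qed.

(* Without a bracket for the smaller set, the right-hand side would be the junk
   value 0. *)
Lemma posterior_variance_subset (R : realType) (K L : set R) (x : R) :
  K `<=` L -> K x \/ bracket K x !=set0 ->
  posterior_variance L x <= posterior_variance K x.
Proof.
move=> KL Kbr; rewrite {1}/posterior_variance.
case: ifPn => [_|xL]; first exact: posterior_variance_ge0.
have xK : x \notin K by apply: contra xL; rewrite !inE; exact: KL.
case: xgetP => [[u v] _ [/= Lu Lv /andP[ux xv] Luv]|_]; last first.
  by rewrite subrr mul0r mul0r posterior_variance_ge0.
rewrite /posterior_variance (negbTE xK).
have {Kbr} : bracket K x !=set0.
  by case: Kbr => // Kx; rewrite notin_setE in xK.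
move=> /(xgetPex (x, x)); case: xget => u' v' [/= Ku' Kv' /andP[u'x xv'] _].
(* Both [u'] and [v'] belong to [L], so neither can lie strictly between the consecutive points [u]
   and [v]. *)
apply: bridge_variance_le => //.
  rewrite leNgt; apply/negP => uu'.
  by have := Luv u' (KL _ Ku'); rewrite uu' (lt_trans u'x xv).
rewrite leNgt; apply/negP => v'v.
by have := Luv v' (KL _ Kv'); rewrite v'v (lt_trans ux xv').
Qed.

(** [counting] is [+oo] on infinite sets and 0 on the empty set, so a positive natural value
    excludes both. *)
Lemma npoints_posnat (R : realType) (T : Type) (K : T -> set R) (B : set R)
    (w : T) (k : nat) :
  npoints K B w = k.+1%:R%:E ->
  finite_set (K w `&` B) /\ K w `&` B !=set0.
Proof.
rewrite /npoints /counting; case: asboolP => // finKB -[kE]; split => //.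
apply/set0P/eqP => KB0; move: kE; rewrite KB0 fset_set0 /=.
by move/esym/eqP; rewrite pnatr_eq0.
Qed.

Section poisson_points.
Context {R : realType} {d : measure_display} {T : measurableType d}.
Context {P : probability T R} {l : R} {K : T -> set R}.
Hypothesis PK : poisson_process P l K.

Lemma measurable_npoints_eq (B : set R) (k : nat) : measurable B ->
  measurable [set w | npoints K B w = k%:R%:E].
Proof.
case: PK => mK _ _ mB.
rewrite -[X in measurable X]setTI.
by apply: (mK B mB _ [set k%:R%:E]) => //; exact: emeasurable_set1.
Qed.

(** The complement collects the counts 0 and [+oo]. The Poisson law has total mass 1 on the
    naturals, so only the mass at 0 remains. *)
Lemma poisson_process_posnat (B : set R) : measurable B ->
  (lebesgue_measure B < +oo)%E ->
  P (~` \bigcup_(k in ~` [set 0%N]) [set w | npoints K B w = k%:R%:E]) =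
  poisson_prob (l * fine (lebesgue_measure B)) 0 [set 0%N].
Proof.
move=> mB Boo; have [_ lawK _] := PK.
set r := l * _.
have mN k : measurable [set w | npoints K B w = k%:R%:E].
  exact: measurable_npoints_eq.
rewrite probability_setC; last exact: bigcup_measurable.
rewrite measure_bigcup//; last first.
  by move=> i j _ _ [w [/= -> /eqP]]; rewrite eqe eqr_nat => /eqP.
rewrite (eq_eseriesr (fun k _ => lawK B k mB Boo)) -/r.
have <- := @measure_bigcup _ _ _ (poisson_prob r 0) (~` [set 0%N])
  (fun k => [set k]); last 2 first.
- by [].
- by move=> i j _ _ [w [/= -> ->]].
rewrite bigcup_imset1 image_id -[in RHS](setCK [set 0%N]).
exact/esym/(@probability_setC _ _ _ (poisson_prob r 0)).
Qed.

Lemma poisson_process_ae_meets (B : nat -> set R) : 0 < l ->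
  (forall n, measurable (B n)) ->
  (forall n, lebesgue_measure (B n) = n.+1%:R%:E) ->
  {ae P, forall w, exists n,
    finite_set (K w `&` B n) /\ K w `&` B n !=set0}.
Proof.
move=> l0 mB Bn.
pose D n := ~` \bigcup_(k in ~` [set 0%N])
  [set w | npoints K (B n) w = k%:R%:E].
have mD n : measurable (D n).
  apply: measurableC; apply: bigcup_measurable => k _.
  exact: measurable_npoints_eq.
have PD n : P (D n) = (expR (- (l * n.+1%:R)))%:E.
  rewrite poisson_process_posnat// Bn ?ltry//= /poisson_prob mulr_gt0//.
  rewrite esum_set1 ?lee_fin ?poisson_pmf_ge0//.
  by rewrite /poisson_pmf mulr_gt0// expr0 fact0 divr1 mul1r.
have mI : measurable (\bigcap_n D n) by exact: bigcap_measurable.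
exists (\bigcap_n D n); split => //; last first.
  move=> w /= nw n _ [[|k] /= k0 wk]; first exact: k0.
  by apply: nw; exists n; exact: npoints_posnat wk.
apply/eqP; rewrite eq_le measure_ge0 andbT leNgt; apply/negP => PI0.
(* A positive probability [p] of the intersection would be at most [expR (- (l * n.+1%:R))] for
   every [n]. *)
have PIfin : P (\bigcap_n D n) \is a fin_num by exact: fin_num_measure.
have p0 : 0 < fine (P (\bigcap_n D n)) by rewrite fine_gt0// PI0 ltey_eq PIfin.
set p := fine _ in p0.
have pn n : p <= expR (- (l * n.+1%:R)).
  rewrite -lee_fin -PD fineK// le_measure ?inE//; exact: bigcap_inf.
(* Choose [n] with [p^-1 < l * n]; this contradicts [l * n <= expR (l * n.+1%:R) <= p^-1], where the
   first bound comes from [1 + y <= expR y]. *)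
have := archi_boundP (ltW (divr_gt0 (etrans (invr_gt0 p) p0) l0)).
set n := Num.bound _; rewrite ltr_pdivrMr// mulrC ltNge => /negP; apply.
apply: (@le_trans _ _ (expR (l * n.+1%:R))).
  apply: le_trans (expR_ge1Dx _).
  by rewrite ler_wpDl// ler_wpM2l ?(ltW l0)// ler_nat.
by rewrite -[leLHS]invrK -expRN lef_pV2 ?posrE ?expR_gt0.
Qed.

End poisson_points.

Theorem proposition3 (R : realType) (d : measure_display)
  (T : measurableType d) (P : probability T R) (lambda0 lambdaS : R)
  (K0 K1 KS : T -> set R) :
  0 < lambda0 -> lambda0 < lambdaS ->
  poisson_process P lambda0 K0 ->
  poisson_process P (lambdaS - lambda0) K1 ->
  independent_points P K0 K1 ->
  (forall w : T, KS w = K0 w `|` K1 w) ->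
  forall x : R,
    {ae P, forall w : T,
      posterior_variance (KS w) x <= posterior_variance (K0 w) x}.
Proof.
move=> l0 _ PK0 _ _ KSE x.
have aer := poisson_process_ae_meets PK0 (fun n => `]x, x + n.+1%:R[%classic) l0.
have ael := poisson_process_ae_meets PK0 (fun n => `]x - n.+1%:R, x[%classic) l0.
apply: filterS2 (ael _ _) (aer _ _) => //; last 2 first.
- move=> n; rewrite lebesgue_measure_itv/= lte_fin ltrBlDr ltrDl ltr0n.
  by rewrite -EFinB opprB addrC subrK.
- move=> n; rewrite lebesgue_measure_itv/= lte_fin ltrDl ltr0n.
  by rewrite -EFinB addrAC subrr add0r.
(* The window lengths that succeed on the two sides of [x] may differ. *)
move=> w [m [finl nel]] [n [finr ner]].
apply: posterior_variance_subset; first by rewrite KSE; exact: subsetUl.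
have [Kx|Kx] := pselect (K0 w x); [by left|right].
exact: bracket_nonempty finl nel finr ner.
Qed.
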